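(* Let $d\ge2$ and let $i,j$ be integers with $i\ge1$, $j\ge0$, $j<d-1$ and $i+j\le d-1$. Define $$f_d(i,j,x)=\sum_{k=0}^{d-1} C_{d-1-k}(1-x)^kx^{d-k}\sum_{s=0}^{j}\binom{j}{s}\binom{d+i+j-1-k-s}{k-s},\qquad C_n=\tfrac1{n+1}\tbinom{2n}{n}.$$ Then for every $m$, the coefficient of $x^{d-m}$ in $f_d(i,j,x)$ equals the number of plane trees on $d$ vertices (labeled $1,\ldots,d$ in postorder) having exactly $m$ vertices $v$ with one of the following properties: $v$ is a type $[0]$ special vertex; $v$ is a type $[1]$ special vertex whose postorder label is at most $i$ or at least $d-j$; $v$ is a type $[2]$ special vertex whose postorder label is at least $d-j$.
   Context: A plane tree is a rooted tree in which the children of each vertex are linearly ordered left to right; the first child is the leftmost child; a leaf has no children. Postorder labeling of a plane tree on $n$ vertices: remove the root, label the subtrees rooted at the root's children, left to right, consecutively and each recursively in postorder, then give the root label $n$. Special vertices: $v$ is type $[0]$ if $v$ is a leaf and the leftmost child of its parent; type $[1]$ if $v$ is a leaf and not the leftmost child of its parent; type $[2]$ if $v$ is not a leaf and is the leftmost child of its parent. ($f_d(i,j,x)$ is the contribution of a shelling component of type $(i,j)$ to the toric $f$-polynomial of a shellable $(d-1)$-dimensional cubical complex.) *)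

(* Defs.v *)
From HB Require Import structures.
From mathcomp Require Import all_boot all_order all_algebra.

Set Implicit Arguments.
Unset Strict Implicit.
Unset Printing Implicit Defensive.

Import GRing.Theory.

(* The list contains the subtrees rooted at the children of the root, from
   left to right. *)
Inductive ptree : Type := Node of seq ptree.

(* A vertex is represented by its address: the root is [::], and the children
   of a vertex v are, from left to right, rcons v 0, rcons v 1, etc. *)
Definition vertex := seq nat.

Fixpoint postorder (t : ptree) : seq vertex :=
  let: Node ts := t in
  flatten [seq [seq p.1 :: v | v <- p.2]
          | p <- zip (iota 0 (size ts)) (map postorder ts)] ++ [:: [::]].

Definition nverts (t : ptree) : nat := size (postorder t).

Definition label (t : ptree) (v : vertex) : nat := (index v (postorder t)).+1.

Definition is_leaf (t : ptree) (v : vertex) : bool :=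
  rcons v 0 \notin postorder t.

(* This is false for the root, which has no parent. *)
Definition is_leftmost_child (v : vertex) : bool :=
  (v != [::]) && (last 0 v == 0).

Definition special0 (t : ptree) (v : vertex) : bool :=
  is_leaf t v && is_leftmost_child v.

Definition special1 (t : ptree) (v : vertex) : bool :=
  [&& is_leaf t v, v != [::] & ~~ is_leftmost_child v].

Definition special2 (t : ptree) (v : vertex) : bool :=
  ~~ is_leaf t v && is_leftmost_child v.

Definition counted (d i j : nat) (t : ptree) (v : vertex) : bool :=
  [|| special0 t v,
      special1 t v && ((label t v <= i) || (d - j <= label t v))
    | special2 t v && (d - j <= label t v)].

Definition ncounted (d i j : nat) (t : ptree) : nat :=
  count (counted d i j t) (postorder t).

(* A tree is determined by the numbers of children of its vertices, listed in
   postorder; this gives a finType of plane trees on d vertices. *)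
Fixpoint ptree_code (t : ptree) : seq nat :=
  let: Node ts := t in rcons (flatten (map ptree_code ts)) (size ts).

Definition ptree_step (st : seq ptree) (k : nat) : seq ptree :=
  Node (rev (take k st)) :: drop k st.

Definition ptree_decode (s : seq nat) : option ptree :=
  ohead (foldl ptree_step [::] s).

Fixpoint ptree_nested_ind (P : ptree -> Prop)
    (PNode : forall ts, foldr (fun t Q => P t /\ Q) True ts -> P (Node ts))
    (t : ptree) : P t :=
  let: Node ts := t in
  PNode ts ((fix F us : foldr (fun t Q => P t /\ Q) True us :=
    if us is u :: us' then conj (ptree_nested_ind PNode u) (F us') else I) ts).

Lemma ptree_code_foldl t st :
  foldl ptree_step st (ptree_code t) = t :: st.
Proof.
elim/ptree_nested_ind: t st => ts IH st /=.
rewrite foldl_rcons.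
suff -> : foldl ptree_step st (flatten (map ptree_code ts)) = rev ts ++ st.
  rewrite /ptree_step -(size_rev ts) take_size_cat //.
  by rewrite drop_size_cat // revK.
elim: ts st IH => [|u us IHus] st //= [IHu /IHus {}IHus].
by rewrite foldl_cat IHu IHus rev_cons cat_rcons.
Qed.

Lemma ptree_codeK : pcancel ptree_code ptree_decode.
Proof. by move=> t; rewrite /ptree_decode ptree_code_foldl. Qed.

Lemma size_ptree_code t : size (ptree_code t) = nverts t.
Proof.
rewrite /nverts; elim/ptree_nested_ind: t => ts IH /=.
rewrite size_rcons size_cat addn1; congr _.+1.
elim: ts 0 IH => [|u us IHus] k //= [IHu IH].
by rewrite !size_cat size_map -IHu -(IHus k.+1 IH).
Qed.

Lemma ptree_code_bound t : all (fun k => k < nverts t) (ptree_code t).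
Proof.
rewrite -size_ptree_code; elim/ptree_nested_ind: t => ts IH /=.
rewrite all_rcons size_rcons ltnS.
have [-> ] : size ts <= size (flatten (map ptree_code ts)) /\
    all (fun k => k < size (flatten (map ptree_code ts)))
        (flatten (map ptree_code ts)).
  elim: ts IH => [|u us IHus] //= [IHu /IHus [le_us all_us]].
  rewrite size_cat all_cat; split.
    by rewrite -add1n leq_add // size_ptree_code /nverts; case: (u) => vs /=;
       rewrite size_cat addn1.
  apply/andP; split.
    by apply: sub_all IHu => k lt_k; apply: leq_trans lt_k (leq_addr _ _).
  by apply: sub_all all_us => k lt_k; apply: leq_trans lt_k (leq_addl _ _).
by apply: sub_all => k; apply: ltnW.
Qed.

HB.instance Definition _ := Countable.copy ptree (pcan_type ptree_codeK).

Record ptree_on (d : nat) : Type := PtreeOn {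
  ptree_val :> ptree;
  ptree_valP : nverts ptree_val == d
}.

HB.instance Definition _ d := [isSub for @ptree_val d].
HB.instance Definition _ d := [Countable of ptree_on d by <:].

Definition ptree_on_code d (t : ptree_on d) : {ffun 'I_d -> 'I_d.+1} :=
  [ffun k : 'I_d => inord (nth 0 (ptree_code t) k)].

Definition ptree_on_decode d (f : {ffun 'I_d -> 'I_d.+1}) :
    option (ptree_on d) :=
  obind insub (ptree_decode [seq val (f k) | k <- enum 'I_d]).

Lemma ptree_on_codeK d : pcancel (@ptree_on_code d) (@ptree_on_decode d).
Proof.
move=> t; rewrite /ptree_on_decode.
suff -> : [seq val (ptree_on_code t k) | k <- enum 'I_d] = ptree_code t.
  by rewrite ptree_codeK /= valK.
have szt : size (ptree_code t) = d.
  by rewrite size_ptree_code; apply/eqP/ptree_valP.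
apply: (@eq_from_nth _ 0); rewrite size_map size_enum_ord ?szt // => k lt_kd.
rewrite (nth_map (Ordinal lt_kd)) ?size_enum_ord // ffunE nth_enum_ord //=.
rewrite inordK // ltnS ltnW // -[ltnRHS]szt size_ptree_code.
by apply: (allP (ptree_code_bound t)); rewrite mem_nth ?szt.
Qed.

HB.instance Definition _ d :=
  isFinite.Build (ptree_on d) (pcan_enumP (@ptree_on_codeK d)).

Local Open Scope ring_scope.

Definition catalan (n : nat) : rat := n.+1%:R^-1 * 'C(2 * n, n)%:R.

(* The condition s <= k drops the terms in which the lower index k - s of the
   second binomial coefficient is negative; these terms are zero, whereas
   truncated subtraction would make them positive. *)
Definition toric_f (d i j : nat) : {poly rat} :=
  \sum_(k < d) catalan (d - 1 - k) *: ((1 - 'X) ^+ k * 'X^(d - k)) *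
    (\sum_(s < j.+1 | (s <= k)%N)
        'C(j, s) * 'C(d + i + j - 1 - k - s, k - s))%N%:R.

(* Main.v *)
Require Import Defs.
From mathcomp Require Import all_boot all_order all_algebra.
From mathcomp Require Import ring zify.

Set Implicit Arguments.
Unset Strict Implicit.
Unset Printing Implicit Defensive.

Import GRing.Theory Num.Theory.

(* Record each vertex other than the root, in postorder, by two bits: whether it
   has a child and whether it has a left sibling. This is a bijection from the
   plane trees with n + 1 vertices onto the words of n letters which, read from
   right to left, are the paths that start at height 1 and reach height 0 for
   the first time at the end, a letter (a, b) being a step of a + b - 1. Types
   [0], [1] and [2] are the down step and the two level steps, so being counted
   depends only on the letter and on its position.

   Put z = y - 1, where y marks the counted vertices. If B denotes the transfer
   operator of an ordinary position, then that of one of the first i positions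
   is B + z, and that of one of the last j positions is B + 2 z. Expanding one
   factor at a time gives recurrences in i and j that the double sum defining
   f_d also satisfies. In the base case i = 1, j = 0 all operators are B, whose
   powers are computed by Lagrange inversion of V = t ((1 + V)^2 + z). *)

(** * Plane trees as words *)

Definition children (t : ptree) : seq ptree := let: Node ts := t in ts.

(** Every tree with at least two vertices is [attach t u] for unique [t] and [u], where [u] is the
    subtree at the last child of the root. Inductions over lists of children thus become binary. *)
Definition attach (t u : ptree) : ptree := Node (rcons (children t) u).

Lemma ptree_attach_ind (P : ptree -> Prop) :
  P (Node [::]) -> (forall t u, P t -> P u -> P (attach t u)) ->
  forall t, P t.
Proof.
move=> P0 Pattach; elim/ptree_nested_ind; elim/last_ind => [//|ts u IH] Pall.
have [Pu Pts] : P u /\ foldr (fun t Q => P t /\ Q) True ts.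
  by elim: ts Pall {IH} => [|t ts IH] /= [Pt] // /IH [].
exact: (Pattach (Node ts) u (IH Pts) Pu).
Qed.

Lemma ptree_case_attach (t : ptree) :
  t = Node [::] \/ exists t' u, t = attach t' u.
Proof.
by elim/ptree_attach_ind: t => [|t u _ _]; [left | right; exists t, u].
Qed.

Definition letter := (bool * bool)%type.

(* The vertices other than the root, in postorder; each is recorded by the
   pair (has a child, has a left sibling). *)
Fixpoint encode (t : ptree) : seq letter :=
  let: Node ts := t in
  flatten [seq rcons p.2 (p.2 != [::], p.1 != 0)
          | p <- zip (iota 0 (size ts)) (map encode ts)].

Lemma encode_attach (t u : ptree) :
  encode (attach t u) =
  encode t ++ rcons (encode u) (encode u != [::], encode t != [::]).
Proof.
case: t => ts; rewrite /attach /= size_rcons -addn1 iotaD map_rcons -cats1.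
rewrite zip_cat ?size_map ?size_iota // map_cat flatten_cat /= cats0.
case: ts => [//|v vs] /=.
by case: (encode v).
Qed.

Lemma encode_attach_neq0 (t u : ptree) : encode (attach t u) != [::].
Proof. by rewrite encode_attach -size_eq0 size_cat size_rcons addnS. Qed.

Lemma encode_eq0 (t : ptree) : encode t = [::] -> t = Node [::].
Proof.
case: (ptree_case_attach t) => [//|[t' [u ->]]] /eqP.
by rewrite (negbTE (encode_attach_neq0 _ _)).
Qed.

(** A stack machine reading the code from left to right. Single-vertex trees have the empty code and
    are never pushed; the bits tell whether [u] and [t] are popped or trivial. *)
Definition decode_step (st : seq ptree) (s : letter) : seq ptree :=
  let u := if s.1 then head (Node [::]) st else Node [::] in
  let st' := if s.1 then behead st else st in
  let t := if s.2 then head (Node [::]) st' else Node [::] in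
  attach t u :: (if s.2 then behead st' else st').

Lemma foldl_decode_encode (t : ptree) (st : seq ptree) :
  foldl decode_step st (encode t) = if encode t == [::] then st else t :: st.
Proof.
elim/ptree_attach_ind: t st => [//|t u IHt IHu] st.
rewrite (negbTE (encode_attach_neq0 _ _)) encode_attach foldl_cat foldl_rcons.
rewrite {}IHt {}IHu.
case: eqP => [/encode_eq0 ->|_]; case: eqP => [/encode_eq0 ->|_] //.
Qed.

Lemma encodeK :
  cancel encode (fun w => head (Node [::]) (foldl decode_step [::] w)).
Proof.
by move=> t; rewrite foldl_decode_encode; case: eqP => [/encode_eq0 ->|].
Qed.

(* Words that arise by concatenating the codes of h nontrivial trees. Removing
   the last letter (a, b) of such a word replaces the last tree by a + b
   trees. *)
Fixpoint path_words (h n : nat) : seq (seq letter) :=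
  match h, n with
  | 0, 0 => [:: [::]]
  | h'.+1, n'.+1 =>
    [seq rcons w s | s : letter <- enum {: letter},
                     w <- path_words (h' + s.1 + s.2) n']
  | _, _ => [::]
  end.

Lemma path_words_size (h n : nat) (w : seq letter) :
  w \in path_words h n -> size w = n.
Proof.
elim: n h w => [|n IH] [|h] w //=; first by rewrite inE => /eqP ->.
by case/allpairsPdep=> s [w' [_ /IH <- ->]]; rewrite size_rcons.
Qed.

Lemma path_words_uniq (h n : nat) : uniq (path_words h n).
Proof.
elim: n h => [|n IH] [|h] //.
apply: allpairs_uniq_dep => [|s _|[s w] [s' w'] _ _ /= /rcons_inj [-> ->] //].
- exact: enum_uniq.
exact: IH.
Qed.

(** If the last tree is [attach t1 t2], dropping the letter of the root of [t2] leaves the codes of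
    [t1] and [t2], of which the nontrivial ones stay in the list. *)
Lemma flatten_encode_path (st : seq ptree) :
  all (fun t => encode t != [::]) st ->
  flatten (map encode st) \in
    path_words (size st) (size (flatten (map encode st))).
Proof.
move: {2}(size _) (erefl (size (flatten (map encode st)))) => n.
elim: n st => [|n IH]; elim/last_ind=> [|st t _] //.
- rewrite all_rcons map_rcons flatten_rcons size_cat => + /andP [+ _].
  by rewrite -size_eq0; case: (size (encode t)) => //= k; rewrite addnS.
rewrite all_rcons => sz_n /andP [].
case: (ptree_case_attach t) => [-> //|[t1 [t2 def_t]]] _ nz_st.
set nontriv := fun t => encode t != [::].
pose st' := st ++ filter nontriv [:: t1; t2].
have def_w : flatten (map encode (rcons st t)) =
    rcons (flatten (map encode st')) (nontriv t2, nontriv t1).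
  rewrite map_rcons flatten_rcons def_t encode_attach map_cat flatten_cat.
  rewrite -!rcons_cat; congr rcons; congr (_ ++ _).
  rewrite /= /nontriv; do 2!case: eqP => [->|_] //=; by rewrite ?cats0.
have nz_st' : all nontriv st' by rewrite all_cat nz_st filter_all.
move: sz_n; rewrite def_w !size_rcons => -[sz_n].
have := IH st' sz_n nz_st'; rewrite sz_n => in_st'.
apply/allpairsPdep; exists (nontriv t2, nontriv t1), (flatten (map encode st')).
split; rewrite ?mem_enum //.
move: in_st'; rewrite size_cat /=.
by case: (nontriv t1); case: (nontriv t2) => /=; rewrite ?addn0 ?addn1 ?addn2.
Qed.

(** Conversely, the bits of the last letter tell which of [t2] and [t1] to take from the end of the
    list; the others are single vertices. *)
Lemma path_words_flatten (h n : nat) (w : seq letter) :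
  w \in path_words h n ->
  exists st, [/\ size st = h, all (fun t => encode t != [::]) st
               & w = flatten (map encode st)].
Proof.
elim: n h w => [|n IH] [|h] w //=.
  by rewrite inE => /eqP ->; exists [::].
case/allpairsPdep=> [[a b]] [w' [_ /IH [st [sz_st nz_st def_w']] ->]].
suff [st0 [t1 [t2 [sz0 nz0 def1 [def2 def3]]]]] : exists st0 t1 t2,
    [/\ size st0 = h, all (fun t => encode t != [::]) st0,
        w' = flatten (map encode st0) ++ encode t1 ++ encode t2
      & (encode t2 != [::]) = a /\ (encode t1 != [::]) = b].
  exists (rcons st0 (attach t1 t2)); split; rewrite ?size_rcons ?sz0 //.
    by rewrite all_rcons nz0 encode_attach_neq0.
  by rewrite map_rcons flatten_rcons encode_attach def2 def3 def1 -!rcons_cat.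
move: sz_st nz_st def_w'; case: a b => [] [] /=; rewrite ?addn0 ?addn1.
- case/lastP: st => [|st t2] //; case/lastP: st => [|st t1] //.
  rewrite !all_rcons !size_rcons !map_rcons !flatten_rcons => -[] <-.
  case/and3P => nz2 nz1 nz0 ->; exists st, t1, t2.
  by rewrite -catA nz2 nz1.
- case/lastP: st => [|st t2] //.
  rewrite all_rcons size_rcons map_rcons flatten_rcons => -[] <-.
  by case/andP => nz2 nz0 ->; exists st, (Node [::]), t2; rewrite nz2.
- case/lastP: st => [|st t1] //.
  rewrite all_rcons size_rcons map_rcons flatten_rcons => -[] <-.
  by case/andP => nz1 nz0 ->; exists st, t1, (Node [::]); rewrite nz1 cats0.
- by move=> <- nz0 ->; exists st, (Node [::]), (Node [::]); rewrite cats0.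
Qed.

(** * Counted vertices as letters *)

Definition nonroots (t : ptree) : seq vertex :=
  flatten [seq [seq p.1 :: v | v <- p.2]
          | p <- zip (iota 0 (size (children t))) (map postorder (children t))].

Lemma postorder_nonroots (t : ptree) : postorder t = rcons (nonroots t) [::].
Proof. by case: t => ts; rewrite -cats1. Qed.

Lemma nonroots_attach (t u : ptree) :
  nonroots (attach t u) =
  nonroots t ++ [seq size (children t) :: v | v <- postorder u].
Proof.
case: t => ts; rewrite /nonroots /attach /= size_rcons -addn1 iotaD map_rcons.
by rewrite -cats1 zip_cat ?size_map ?size_iota // map_cat flatten_cat /= cats0.
Qed.

Lemma nonrootsP (t : ptree) (v : vertex) :
  v \in nonroots t -> exists k v', v = k :: v' /\ k < size (children t).
Proof.
elim/ptree_attach_ind: t v => [|t u IHt _] v //.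
rewrite nonroots_attach mem_cat size_rcons => /orP [/IHt|].
  by case=> k [v' [-> lt_k]]; exists k, v'; rewrite ltnW.
by case/mapP=> v' _ ->; exists (size (children t)), v'.
Qed.

Lemma postorder_uniq (t : ptree) : uniq (postorder t).
Proof.
elim/ptree_attach_ind: t => [//|t u].
rewrite !postorder_nonroots !rcons_uniq => /andP [_ uniq_t] /andP [_ uniq_u].
apply/andP; split; first by apply/negP => /nonrootsP [k [v' []]].
rewrite nonroots_attach cat_uniq uniq_t map_inj_uniq => [|v v' []//].
rewrite postorder_nonroots rcons_uniq uniq_u andbT /=.
apply/andP; split; last by apply/negP => /nonrootsP [k [v' []]].
apply/hasPn=> _ /mapP [v _ ->] /=; apply/negP => /nonrootsP [k [v' []]].
by case=> <- _; rewrite ltnn.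
Qed.

Definition vertex_letter (t : ptree) (v : vertex) : letter :=
  (~~ is_leaf t v, ~~ is_leftmost_child v).

Lemma size_encode (t : ptree) : size (encode t) = size (nonroots t).
Proof.
elim/ptree_attach_ind: t => [//|t u IHt IHu].
rewrite encode_attach nonroots_attach !size_cat IHt size_map size_rcons IHu.
by rewrite postorder_nonroots size_rcons.
Qed.

Lemma nverts_encode (t : ptree) : nverts t = (size (encode t)).+1.
Proof. by rewrite size_encode /nverts postorder_nonroots size_rcons. Qed.

Lemma nonroots_eq0 (t : ptree) : (nonroots t == [::]) = (encode t == [::]).
Proof. by rewrite -!size_eq0 size_encode. Qed.

Lemma root_leaf (t : ptree) : is_leaf t [::] = (encode t == [::]).
Proof.
rewrite -nonroots_eq0 /is_leaf postorder_nonroots mem_rcons inE /=.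
case: t => -[//|[us] ts]; rewrite /nonroots /=.
by rewrite map_cat /= -catA mem_cat mem_cat inE eqxx orbT /=; case: map.
Qed.

(** Attaching [u] keeps the addresses in [t] and prefixes those in [u] by the index of the new
    child. Letters are preserved, and the root of [u] receives a new one. *)
Lemma map_vertex_letter (t : ptree) :
  map (vertex_letter t) (nonroots t) = encode t.
Proof.
elim/ptree_attach_ind: t => [//|t u IHt IHu].
rewrite encode_attach nonroots_attach map_cat; congr (_ ++ _).
  rewrite -{}IHt; apply/eq_in_map=> v v_t; congr (~~ _, _).
  rewrite /is_leaf !postorder_nonroots !mem_rcons !inE nonroots_attach mem_cat.
  case: (nonrootsP v_t) => k [v' [-> lt_k]] /=.
  rewrite [X in _ || X](negbTE _) ?orbF //.
  by apply/mapP=> -[v'' _ [eq_k]]; rewrite eq_k ltnn in lt_k.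
have leafE v : is_leaf (attach t u) (size (children t) :: v) = is_leaf u v.
  rewrite /is_leaf [in LHS]postorder_nonroots mem_rcons inE nonroots_attach.
  rewrite mem_cat /= [X in X || _](negbTE _) /=; last first.
    by apply/negP=> /nonrootsP [k [v' [[<-]]]]; rewrite ltnn.
  by rewrite mem_map // => v1 v2 [].
rewrite postorder_nonroots !map_rcons -map_comp; congr rcons.
  rewrite -IHu; apply/eq_in_map=> v v_u; rewrite /= /vertex_letter.
  rewrite leafE; congr (_, _).
  by case: (nonrootsP v_u) => k [v' [-> _]].
rewrite /vertex_letter leafE root_leaf; congr (_, _).
by case: t {IHt leafE} => -[|t ts] //=; case: (encode t).
Qed.

(** Positions [l] count from 0, so the postorder label is [l.+1]. The disjuncts are types [0], [1]
    and [2]. *)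
Definition letter_counted (d i j l : nat) (s : letter) : bool :=
  [|| ~~ s.1 && ~~ s.2,
      [&& ~~ s.1, s.2 & (l < i) || (d - j <= l.+1)]
    | [&& s.1, ~~ s.2 & d - j <= l.+1]].

Definition word_count (d i j : nat) (w : seq letter) : nat :=
  \sum_(l < size w) letter_counted d i j l (nth (false, false) w l).

Lemma word_count_rcons (d i j : nat) (w : seq letter) (s : letter) :
  word_count d i j (rcons w s) =
  word_count d i j w + letter_counted d i j (size w) s.
Proof.
rewrite /word_count size_rcons big_ord_recr /= nth_rcons ltnn eqxx.
by congr addn; apply: eq_bigr => l _; rewrite nth_rcons ltn_ord.
Qed.

Lemma ncounted_encode (d i j : nat) (t : ptree) :
  ncounted d i j t = word_count d i j (encode t).
Proof.
rewrite /ncounted postorder_nonroots -cats1 count_cat /= /counted.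
(* The root has no parent, hence no special type, and contributes nothing. *)
rewrite /special0 /special1 /special2 /is_leftmost_child /= !andbF !addn0.
rewrite -sum1_count (big_nth [::]) big_mkord big_mkcond /=.
rewrite /word_count -map_vertex_letter size_map; apply: eq_bigr => l _.
rewrite (nth_map [::]) //; set v := nth _ _ _.
have v_t : v \in nonroots t by apply: mem_nth.
have lbl : label t v = l.+1.
  rewrite /label postorder_nonroots -cats1 index_cat v_t index_uniq //.
  have := postorder_uniq t.
  by rewrite postorder_nonroots rcons_uniq => /andP [].
have nz_v : v != [::] by case: (nonrootsP v_t) => k [v' [-> _]].
rewrite /letter_counted /= lbl nz_v /is_leftmost_child nz_v /= !negbK -!andbA.
by case: is_leaf; case: (_ == 0); case: (_ || _); case: (d - j <= _).
Qed.

Local Open Scope ring_scope.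

(** * The transfer operators *)

(* Appending one vertex to all words: c is the number of level letters that are
   counted at the position of this vertex, and 1 + z the weight of a counted
   vertex. *)
Definition path_step (z : {poly rat}) (c : nat) (f : nat -> {poly rat})
    (h : nat) : {poly rat} :=
  if h is h'.+1 then
    f h'.+2 + (2%:R + c%:R * z) * f h'.+1 + (1 + z) * f h'
  else 0.

Lemma eq_step (z : {poly rat}) (c : nat) (f g : nat -> {poly rat}) :
  f =1 g -> path_step z c f =1 path_step z c g.
Proof. by move=> eq_fg [|h] //=; rewrite !eq_fg. Qed.

Lemma eq_iter_step (z : {poly rat}) (c m : nat) (f g : nat -> {poly rat}) :
  f =1 g -> iter m (path_step z c) f =1 iter m (path_step z c) g.
Proof. by move=> eq_fg; elim: m => [//|m IH] /=; apply: eq_step. Qed.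

Lemma iter_stepD (z a : {poly rat}) (c p : nat) (f g k : nat -> {poly rat}) :
  (forall h, f h = g h + a * k h) ->
  forall h, iter p (path_step z c) f h
            = iter p (path_step z c) g h + a * iter p (path_step z c) k h.
Proof.
move=> def_f; elim: p => [//|p IH] [|h] /=; first by ring.
by rewrite !IH; ring.
Qed.

(** The splitting into B and c z; [f 0 = 0] matters at height 0, where [path_step] vanishes. *)
Lemma step_shift (z : {poly rat}) (c : nat) (f : nat -> {poly rat}) :
  f 0 = 0 -> forall h, path_step z c f h = path_step z 0 f h + c%:R * z * f h.
Proof. by move=> f0 [|h] /=; rewrite ?f0; ring. Qed.

(** * Recurrences for the double sum *)

(** For k <= N, the coefficient of x^k in (1 + x)^j / (1 - x)^(N - k + 1). *)
Definition bin_conv (N k j : nat) : nat :=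
  (\sum_(s < j.+1 | s <= k) 'C(j, s) * 'C(N - s, k - s))%N.

Lemma bin_conv0 (N j : nat) : bin_conv N 0 j = 1.
Proof.
rewrite /bin_conv big_mkcond big_ord_recl /= bin0 subn0 bin0.
by rewrite big1 // => s _; rewrite leqn0.
Qed.

(** Pascal's rule for the second binomial of each term; [j <= N] keeps [N - s] from being
    truncated. *)
Lemma bin_convS (N k j : nat) : (j <= N)%N ->
  bin_conv N.+1 k.+1 j = (bin_conv N k.+1 j + bin_conv N k j)%N.
Proof.
move=> le_jN; rewrite /bin_conv !(big_mkcond (fun s : 'I_ _ => leq _ _)).
rewrite -big_split /=; apply: eq_bigr => s _.
case: (ltngtP s k.+1) => [lt_sk|lt_ks|->].
- have le_sN : (s <= N)%N by rewrite (leq_trans _ le_jN) // -ltnS.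
  rewrite ltnS in lt_sk; rewrite lt_sk !subSn //.
  by rewrite binS mulnDr.
- by rewrite leqNgt (ltnW lt_ks).
by rewrite ltnn !subnn !bin0 addn0.
Qed.

Lemma bin_conv_Sj (N k j : nat) :
  bin_conv N.+1 k.+1 j.+1 = (bin_conv N.+1 k.+1 j + bin_conv N k j)%N.
Proof.
rewrite /bin_conv !(big_mkcond (fun s : 'I_ _ => leq _ _)).
rewrite big_ord_recl [in RHS]big_ord_recl /= !bin0 -addnA; congr addn.
under eq_bigr do rewrite binS subSS ltnS mulnDl.
have split_if (b : bool) m n : (if b then m + n else 0)%N =
  ((if b then m else 0) + (if b then n else 0))%N by case: b.
under eq_bigr do rewrite split_if.
rewrite big_split /= big_ord_recr /= bin_small // mul0n if_same addn0.
by congr addn; apply: eq_bigr.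
Qed.

(** With z = 1 / x - 1 and n = d - 1, x^d times this sum is f_d(i, j, x). *)
Definition toric_sum (z : {poly rat}) (n i j : nat) : {poly rat} :=
  \sum_(k < n.+1) catalan (n - k) *: z ^+ k *
    (bin_conv (n + i + j - k) k j)%:R.

Lemma toric_sum_Si (z : {poly rat}) (n i j : nat) :
  toric_sum z n.+1 i.+1 j = toric_sum z n.+1 i j + z * toric_sum z n i j.
Proof.
rewrite /toric_sum big_ord_recl [in RHS]big_ord_recl /= !bin_conv0 -addrA.
congr (_ + _); rewrite mulr_sumr -big_split /=; apply: eq_bigr => k _.
have le_kn : (k <= n)%N by rewrite -ltnS.
rewrite /bump /= add1n subSS.
have -> : (n.+1 + i.+1 + j - k.+1 = (n + i + j - k).+1)%N by lia.
have -> : (n.+1 + i + j - k.+1 = n + i + j - k)%N by lia.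
rewrite bin_convS; last by lia.
by rewrite natrD exprS -!mul_polyC; ring.
Qed.

Lemma toric_sum_Sj (z : {poly rat}) (n i j : nat) :
  toric_sum z n.+1 i j.+1 =
  toric_sum z n.+1 i j + 2%:R * z * toric_sum z n i j.
Proof.
rewrite /toric_sum big_ord_recl [in RHS]big_ord_recl /= !bin_conv0 -addrA.
congr (_ + _); rewrite mulr_sumr -big_split /=; apply: eq_bigr => k _.
have le_kn : (k <= n)%N by rewrite -ltnS.
rewrite /bump /= add1n subSS.
have -> : (n.+1 + i + j.+1 - k.+1 = (n + i + j - k).+1)%N by lia.
have -> : (n.+1 + i + j - k.+1 = n + i + j - k)%N by lia.
(* Each of the two recurrences leaves one copy of [bin_conv (n + i + j - k) k j], whence the factor
   2. *)
rewrite bin_conv_Sj bin_convS; last by lia.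
by rewrite !natrD exprS -!mul_polyC; ring.
Qed.

(** * Powers of the ordinary transfer operator *)

(* By Lagrange inversion, the coefficient of z^k t^n in V^h, where
   V = t ((1 + V)^2 + z); the formula is wrong for n = 0. *)
Definition path_coef (n h k : nat) : rat :=
  if (h <= n)%N then
    h%:R / n%:R * ('C(n, k) * 'C(2 * (n - k), n - h))%:R
  else 0.

(** For r > m truncated subtraction would give 1 instead of 0. *)
Definition bin_down (N m r : nat) : rat :=
  if (r <= m)%N then 'C(N, m - r)%:R else 0.

Lemma bin_down_pascal (N m : nat) :
  'C(N.+2, m)%:R = bin_down N m 2 + 2%:R * bin_down N m 1 + 'C(N, m)%:R.
Proof.
case: m => [|[|m]]; rewrite /bin_down /= ?bin0 ?bin1 ?subn0.
- by ring.
- by rewrite -addn2 natrD; ring.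
by rewrite !subSS !subn0 !binS !natrD; ring.
Qed.

(** The ratios of consecutive binomials turn every term into a multiple of ['C(N, m - 1)], and the
    coefficients cancel. *)
Lemma bin_down_linear (N m : nat) :
  (m%:R - N%:R - 2%:R) * bin_down N m 2
  + (2%:R * m%:R - N%:R - 2%:R) * bin_down N m 1 + m%:R * 'C(N, m)%:R = 0.
Proof.
have succ l : l.+1%:R * 'C(N, l.+1)%:R = (N%:R - l%:R) * 'C(N, l)%:R :> rat.
  have [le_lN|lt_Nl] := leqP l N; last by rewrite !bin_small ?mulr0 // ltnW.
  by rewrite -natrB // -!natrM mul_bin_left.
case: m => [|[|m]]; rewrite /bin_down /= ?bin0 ?bin1 ?subn0.
- by ring.
- by ring.
have succ_m := succ m; have succ_m1 := succ m.+1.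
rewrite !subSS !subn0 succ_m1.
have -> : (m.+2%:R - N%:R - 2%:R) * 'C(N, m)%:R =
    - ((N%:R - m%:R) * 'C(N, m)%:R) :> rat by ring.
by rewrite -succ_m; ring.
Qed.

Lemma path_coef_sub (n h r k : nat) : (h <= n)%N ->
  path_coef n (h + r) k =
  (h + r)%:R / n%:R * 'C(n, k)%:R * bin_down (2 * (n - k)) (n - h) r.
Proof.
move=> le_hn; rewrite /path_coef /bin_down leq_subRL // natrM.
by case: ifP; rewrite ?mulr0 // mulrA subnDA.
Qed.

Lemma path_coef_gt (n h k : nat) : (n < h)%N -> path_coef n h k = 0.
Proof. by rewrite /path_coef ltnNge; case: leq. Qed.

Lemma path_coef_small (n h k : nat) : (n < k)%N -> path_coef n h k = 0.
Proof.
move=> lt_nk; rewrite /path_coef bin_small // mul0n mulr0.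
by case: leq.
Qed.

(** The coefficient of z^(k+1) t^(n+1) in V^(h+1) = t V^h ((1 + V)^2 + z). *)
Lemma path_coefSS (n h k : nat) : (0 < n)%N ->
  path_coef n.+1 h.+1 k.+1 =
  path_coef n h.+2 k.+1 + 2%:R * path_coef n h.+1 k.+1
  + path_coef n h k.+1 + path_coef n h k.
Proof.
move=> n_gt0; have [lt_nh|le_hn] := ltnP n h.
  by rewrite !path_coef_gt ?mulr0 ?addr0 //; lia.
have [lt_nk|le_kn] := ltnP n k.
  by rewrite !path_coef_small ?mulr0 ?addr0 //; lia.
have nz_n : n%:R != 0 :> rat by rewrite pnatr_eq0 -lt0n.
have [eq_kn|ne_kn] := eqVneq k n.
  rewrite eq_kn !(@path_coef_small n _ n.+1) // /path_coef ltnS.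
  rewrite le_hn !subnn !binn.
  rewrite subSS !mul1n; have [->|ne_hn] := eqVneq h n.
    by rewrite subnn bin0 !divff ?pnatr_eq0 -?lt0n //; ring.
  by rewrite bin_small ?subn_gt0 ?ltn_neqAle ?ne_hn //; ring.
pose e := (n - k)%N; pose m := (n - h)%N.
have def_n : n%:R = e%:R + k%:R :> rat by rewrite -natrD /e subnK.
have def_m : h%:R = e%:R + k%:R - m%:R :> rat.
  by rewrite -def_n natrB // opprB addrC subrK.
have binSk : 'C(n, k.+1)%:R = e%:R / k.+1%:R * 'C(n, k)%:R :> rat.
  have := mul_bin_left n k => /(congr1 (fun x => x%:R : rat)).
  rewrite !natrM => eq_bin; apply: (mulfI (_ : k.+1%:R != 0)).
    by rewrite pnatr_eq0.
  by rewrite eq_bin mulrA mulrCA divff ?mulr1 ?pnatr_eq0.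
have binSSk : 'C(n.+1, k.+1)%:R = n.+1%:R / k.+1%:R * 'C(n, k)%:R :> rat.
  have := mul_bin_diag n.+1 k => /(congr1 (fun x => x%:R : rat)).
  rewrite !natrM => eq_bin; apply: (mulfI (_ : k.+1%:R != 0)).
    by rewrite pnatr_eq0.
  by rewrite -eq_bin mulrA mulrCA divff ?mulr1 ?pnatr_eq0.
have [N def_N def_NN] : exists2 N, (2 * (n - k.+1) = N)%N &
    (2 * (n - k) = N.+2)%N by exists (2 * (n - k.+1))%N; lia.
have N_e : N%:R = 2%:R * e%:R - 2%:R :> rat.
  by apply/eqP; rewrite eq_sym subr_eq -natrM -natrD /e def_NN addn2.
have lin := bin_down_linear N m; have pas := bin_down_pascal N m.
have -> : path_coef n.+1 h.+1 k.+1 =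
    h.+1%:R / n.+1%:R * 'C(n.+1, k.+1)%:R * 'C(N.+2, m)%:R.
  by rewrite /path_coef ltnS le_hn !subSS def_NN natrM mulrA.
have bin_down0 M : bin_down M m 0 = 'C(M, m)%:R by rewrite /bin_down subn0.
have := path_coef_sub 2 k.+1 le_hn; rewrite addn2 def_N -/m => ->.
have := path_coef_sub 1 k.+1 le_hn; rewrite addn1 def_N -/m => ->.
have := path_coef_sub 0 k.+1 le_hn; rewrite addn0 def_N -/m bin_down0 => ->.
have := path_coef_sub 0 k le_hn; rewrite addn0 def_NN -/m bin_down0 pas => ->.
rewrite binSk binSSk; apply/eqP; rewrite -subr_eq0; apply/eqP.
set S2 := bin_down N m 2 in lin *; set S1 := bin_down N m 1 in lin *.
set S0 := 'C(N, m)%:R in lin *.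
(* Up to this common factor, the difference of the two sides is the expression that
   [bin_down_linear] shows to be zero. *)
transitivity ('C(n, k)%:R / (n%:R * k.+1%:R) *
  ((m%:R - N%:R - 2%:R) * S2 + (2%:R * m%:R - N%:R - 2%:R) * S1 + m%:R * S0)).
  rewrite N_e -[h.+2]addn2 -[h.+1]addn1 -[k.+1]addn1 -[n.+1]addn1 !natrD.
  have nz_n1 : n%:R + 1 != 0 :> rat by rewrite natr1 pnatr_eq0.
  have nz_k1 : k%:R + 1 != 0 :> rat by rewrite natr1 pnatr_eq0.
  rewrite def_m; move: nz_n nz_n1; rewrite def_n => nz_n nz_n1.
  by field; rewrite nz_n nz_n1 nz_k1.
by rewrite lin mulr0.
Qed.

(** The constant term in z of the same identity, to which z V^h contributes nothing. *)
Lemma path_coefS0 (n h : nat) : (0 < n)%N ->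
  path_coef n.+1 h.+1 0 =
  path_coef n h.+2 0 + 2%:R * path_coef n h.+1 0 + path_coef n h 0.
Proof.
move=> n_gt0; have [lt_nh|le_hn] := ltnP n h.
  by rewrite !path_coef_gt ?mulr0 ?addr0 //; lia.
have nz_n : n%:R != 0 :> rat by rewrite pnatr_eq0 -lt0n.
have nz_n1 : n%:R + 1 != 0 :> rat by rewrite natr1 pnatr_eq0.
pose m := (n - h)%N.
have def_m : h%:R = n%:R - m%:R :> rat by rewrite natrB // opprB addrC subrK.
pose N := (2 * n)%N.
have lin := bin_down_linear N m; have pas := bin_down_pascal N m.
have -> : path_coef n.+1 h.+1 0 = h.+1%:R / n.+1%:R * 'C(N.+2, m)%:R.
  rewrite /path_coef ltnS le_hn subSS bin0 mul1n subn0 /N.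
  by congr (_ * 'C(_, _)%:R); lia.
have def_N : (2 * (n - 0) = N)%N by rewrite subn0.
have bin_down0 : bin_down N m 0 = 'C(N, m)%:R by rewrite /bin_down subn0.
have := path_coef_sub 2 0 le_hn; rewrite addn2 def_N -/m bin0 => ->.
have := path_coef_sub 1 0 le_hn; rewrite addn1 def_N -/m bin0 => ->.
have := path_coef_sub 0 0 le_hn; rewrite addn0 def_N -/m bin_down0 bin0 => ->.
rewrite pas; apply/eqP; rewrite -subr_eq0; apply/eqP.
set S2 := bin_down N m 2 in lin *; set S1 := bin_down N m 1 in lin *.
set S0 := 'C(N, m)%:R in lin *.
transitivity ((n%:R * n.+1%:R)^-1 *
  ((m%:R - N%:R - 2%:R) * S2 + (2%:R * m%:R - N%:R - 2%:R) * S1 + m%:R * S0)).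
  rewrite -[h.+2]addn2 -[h.+1]addn1 -[n.+1]addn1 /N natrM !natrD def_m.
  by field; rewrite nz_n nz_n1.
by rewrite lin mulr0.
Qed.



Definition path_gf (z : {poly rat}) (n h : nat) : {poly rat} :=
  \sum_(k < n.+1) path_coef n h k *: z ^+ k.
Lemma path_gf_wide (z : {poly rat}) (n h K : nat) : (n < K)%N ->
  path_gf z n h = \sum_(k < K) path_coef n h k *: z ^+ k.
Proof.
move=> lt_nK; rewrite /path_gf.
rewrite (big_ord_widen _ (fun k => path_coef n h k *: z ^+ k) lt_nK).
rewrite big_mkcond /=; apply: eq_bigr => k _; case: ltnP => // lt_nk.
by rewrite path_coef_small ?scale0r.
Qed.

Lemma path_gf_step (z : {poly rat}) (n h : nat) :
  path_gf z n.+2 h = path_step z 0 (path_gf z n.+1) h.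
Proof.
case: h => [|h] /=.
  rewrite /path_gf big1 // => k _.
  by rewrite /path_coef !mul0r scale0r.
transitivity (path_gf z n.+1 h.+2 + 2%:R * path_gf z n.+1 h.+1
              + path_gf z n.+1 h + z * path_gf z n.+1 h); last by ring.
have path_gfS m l : (m <= n.+2)%N -> path_gf z m l =
    (path_coef m l 0)%:P + \sum_(k < n.+2) path_coef m l k.+1 *: z ^+ k.+1.
  rewrite -ltnS => /(path_gf_wide z l) ->; rewrite big_ord_recl expr0 alg_polyC.
  by congr (_ + _); apply: eq_bigr.
rewrite [X in z * X]/path_gf !path_gfS // path_coefS0 //.
under eq_bigr do rewrite path_coefSS //.
rewrite !mulrDr !mulr_sumr !polyCD polyCM.
have split4 : \sum_(k < n.+2) (path_coef n.+1 h.+2 k.+1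
    + 2%:R * path_coef n.+1 h.+1 k.+1 + path_coef n.+1 h k.+1
    + path_coef n.+1 h k) *: z ^+ k.+1 =
    \sum_(k < n.+2) path_coef n.+1 h.+2 k.+1 *: z ^+ k.+1
    + \sum_(k < n.+2) 2%:R * (path_coef n.+1 h.+1 k.+1 *: z ^+ k.+1)
    + \sum_(k < n.+2) path_coef n.+1 h k.+1 *: z ^+ k.+1
    + \sum_(k < n.+2) z * (path_coef n.+1 h k *: z ^+ k).
  rewrite -!big_split; apply: eq_bigr => k _ /=.
  by rewrite exprS -!mul_polyC !polyCD polyCM -polyC_natr; ring.
by rewrite {}split4 polyC_natr; ring.
Qed.

(** The weights of the one-letter words: a single counted down step. Iteration starts here because
    [path_coef] is wrong for the empty word. *)
Definition path1 (z : {poly rat}) (h : nat) : {poly rat} :=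
  if h == 1 then 1 + z else 0.

Lemma path_gf1 (z : {poly rat}) (h : nat) : path_gf z 1 h = path1 z h.
Proof.
rewrite /path_gf !big_ord_recl big_ord0 /path_coef /path1 /=.
case: h => [|[|h]] /=; rewrite /bump /=.
- by rewrite !mul0r !scale0r !addr0.
- by rewrite !addn0 !subnn !bin0 binn divr1 mulr1 !scale1r addr0.
by rewrite !scale0r !addr0.
Qed.

Lemma path_gf_iter (z : {poly rat}) (n h : nat) :
  path_gf z n.+1 h = iter n (path_step z 0) (path1 z) h.
Proof.
elim: n h => [|n IH] h; first exact: path_gf1.
by rewrite path_gf_step /=; case: h => [//|h]; rewrite /= !IH.
Qed.

Lemma natr_bin (n m : nat) : (m <= n)%N ->
  'C(n, m)%:R = n`!%:R / (m`!%:R * (n - m)`!%:R) :> rat.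
Proof.
move=> le_mn; rewrite -(bin_fact le_mn) !natrM mulfK //.
by rewrite mulf_neq0 // pnatr_eq0 -lt0n fact_gt0.
Qed.

Lemma path_coef1 (n k : nat) : (0 < n)%N -> (k <= n)%N ->
  path_coef n 1 k = catalan (n - k) * 'C(n.+1 - k, k)%:R.
Proof.
move=> n_gt0 le_kn; rewrite /path_coef n_gt0 /catalan natrM.
set e := (n - k)%N; have -> : (n.+1 - k = e.+1)%N by rewrite subSn.
have [lt_ek|le_ke] := ltnP e.+1 k.
  (* Both sides vanish: k > e + 1 also gives n - 1 > 2 e. *)
  rewrite (@bin_small e.+1) //.
  by rewrite (@bin_small (2 * e)) ?muln0 ?mulr0 ?mul0r //; lia.
rewrite !natr_bin //; try lia.
have -> : (2 * e - (n - 1) = e.+1 - k)%N by lia.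
have -> : (2 * e - e = e)%N by lia.
have nz_fact l : l`!%:R != 0 :> rat by rewrite pnatr_eq0 -lt0n fact_gt0.
case: n => [//|n] in n_gt0 le_kn e le_ke *.
rewrite -/e factS (factS e) !natrM -!natr1 subn1 /=.
have nz_n : n%:R + 1 != 0 :> rat by rewrite natr1 pnatr_eq0.
have nz_e : e%:R + 1 != 0 :> rat by rewrite natr1 pnatr_eq0.
by field; rewrite nz_n nz_e !nz_fact.
Qed.

Lemma path_gf_toric (z : {poly rat}) (n : nat) : (0 < n)%N ->
  path_gf z n 1 = toric_sum z n 1 0.
Proof.
move=> n_gt0; apply: eq_bigr => k _.
have le_kn : (k <= n)%N by rewrite -ltnS.
rewrite path_coef1 // /bin_conv (big_pred1 ord0) => [|s]; last first.
  by rewrite [s]ord1 leq0n.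
rewrite bin0 mul1n !subn0 addn0 addn1.
by rewrite !mulr_natr scalerMnl.
Qed.

(** * Expansion of the marked positions *)

(** The first position is [path1], so [a] stands for i - 1. The marked position next to the ordinary
    block either joins that block or is deleted, with a factor z or 2 z, as in the recurrences for
    [toric_sum]. *)
Lemma iter_step_toric (z : {poly rat}) (p a j : nat) :
  iter j (path_step z 2)
    (iter p (path_step z 0) (iter a (path_step z 1) (path1 z))) 1 =
  toric_sum z (p + a + j).+1 a.+1 j.
Proof.
have iter0 f c m : f 0 = 0 -> iter m (path_step z c) f 0 = 0.
  by case: m => [|m].
have p1_0 : path1 z 0 = 0 by [].
elim: j p a => [|j IHj] p a.
  rewrite addn0 /=; elim: a p => [|a IHa] p.
    by rewrite addn0 -path_gf_iter path_gf_toric.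
  rewrite (iter_stepD _ _ _ (step_shift z 1 (iter0 _ _ _ p1_0))) -iterSr !IHa.
  by rewrite mul1r -toric_sum_Si addnS.
rewrite iterSr (iter_stepD _ _ _ (step_shift z 2 _)); last first.
  by rewrite !iter0.
by rewrite -[path_step z 0 _]/(iter p.+1 _ _) !IHj -toric_sum_Sj addnS.
Qed.

(** * Generating functions of trees *)

Definition word_gf (d i j h n : nat) : {poly rat} :=
  \sum_(w <- path_words h n) 'X^(word_count d i j w).

Lemma word_gf0n (d i j n : nat) : word_gf d i j 0 n = (n == 0)%:R.
Proof.
case: n => [|n]; last by rewrite /word_gf big_nil.
by rewrite /word_gf big_seq1 /word_count big_ord0.
Qed.

Lemma word_gfS (d i j h n : nat) :
  word_gf d i j h.+1 n.+1 =
  \sum_(s : letter)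
    'X^(letter_counted d i j n s) * word_gf d i j (h + s.1 + s.2) n.
Proof.
rewrite /word_gf /= big_allpairs_dep big_enum /=; apply: eq_bigr => s _.
rewrite mulr_sumr big_seq [RHS]big_seq; apply: eq_bigr => w w_in.
by rewrite word_count_rcons (path_words_size w_in) exprD mulrC.
Qed.

(** The down letter is always counted and the up letter never; [i < d - j] keeps the early and late
    positions apart. *)
Lemma word_gf_step (d i j n c h : nat) :
    c = (if n < i then 1 else if d - j <= n.+1 then 2 else 0)%N ->
    (i < d - j)%N ->
  word_gf d i j h n.+1 =
  path_step ('X - 1) c (word_gf d i j ^~ n) h.
Proof.
move=> -> lt_ij; case: h => [|h] /=; first by rewrite word_gf0n.
rewrite word_gfS -(pair_bigA _ (fun a b => 'X^(letter_counted d i j n (a, b))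
  * word_gf d i j (h + a + b) n)) /= !big_bool /= /letter_counted /=.
rewrite !addn0 !addn1; case: (ltnP n i) => [lt_ni|le_in] /=.
  have -> : (d - j <= n.+1)%N = false by lia.
  by rewrite expr0 expr1; ring.
by case: leq; rewrite /= ?expr0 ?expr1; ring.
Qed.

Lemma word_gf1 (d i j h : nat) : (0 < i)%N -> (i < d - j)%N ->
  word_gf d i j h 1 = path1 ('X - 1) h.
Proof.
move=> i_gt0 lt_ij; rewrite (word_gf_step _ (erefl _) lt_ij) i_gt0.
have gf_h0 k : word_gf d i j k 0 = (k == 0)%:R.
  by case: k => [|k]; rewrite ?word_gf0n // /word_gf big_nil.
by case: h => [|[|h]] //=; rewrite !gf_h0 /path1 /=; ring.
Qed.

Lemma word_gf_iter (d i j n0 c m : nat) : (i < d - j)%N ->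
    (forall n, n0 <= n < n0 + m ->
      c = (if n < i then 1 else if d - j <= n.+1 then 2 else 0))%N ->
  word_gf d i j ^~ (n0 + m)%N =1
  iter m (path_step ('X - 1) c) (word_gf d i j ^~ n0).
Proof.
move=> lt_ij; elim: m => [|m IH] def_c h; first by rewrite addn0.
rewrite addnS (@word_gf_step _ _ _ _ c) //=; last by apply: def_c; lia.
by apply: eq_step => {}h; rewrite IH // => n le_n; apply: def_c; lia.
Qed.

Lemma word_gf_toric (d i j : nat) :
    (0 < i)%N -> (j < d - 1)%N -> (i + j <= d - 1)%N ->
  word_gf d i j 1 (d - 1) = toric_sum ('X - 1) (d - 1) i j.
Proof.
move=> i_gt0 lt_jd le_ijd.
have lt_ij : (i < d - j)%N by lia.
(* The blocks are the first position, the other i - 1 early ones, p ordinary ones and the last j;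
   the last block is the outermost operator. *)
pose a := i.-1; pose p := (d - 1 - j - i)%N.
have -> : (d - 1 = 1 + a + p + j)%N by lia.
rewrite (@word_gf_iter _ _ _ _ 2) //; last first.
  by move=> n le_n; case: ltnP => ?; [lia | case: leqP; lia].
rewrite (eq_iter_step _ _ _ (@word_gf_iter _ _ _ _ 0 _ lt_ij _)); last first.
  by move=> n le_n; case: ltnP => ?; [lia | case: leqP; lia].
rewrite (eq_iter_step _ _ _ (eq_iter_step _ _ _
  (@word_gf_iter _ _ _ _ 1 _ lt_ij _))); last first.
  by move=> n le_n; case: ltnP => ?; [lia | case: leqP; lia].
rewrite (eq_iter_step _ _ _ (eq_iter_step _ _ _ (eq_iter_step _ _ _
  (fun h => word_gf1 h i_gt0 lt_ij)))).
by rewrite iter_step_toric; congr toric_sum; lia.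
Qed.

(** As d > 1, the trees are nontrivial, and [encode] maps them bijectively onto the words that start
    at height 1. *)
Lemma ptree_gf (d i j : nat) : (1 < d)%N ->
  \sum_(t : ptree_on d) 'X^(ncounted d i j t) = word_gf d i j 1 (d - 1).
Proof.
move=> d_gt1; under eq_bigr do rewrite ncounted_encode.
rewrite /word_gf -big_enum /=.
rewrite -(big_map (fun t : ptree_on d => encode t) xpredT
  (fun w => 'X^(word_count d i j w))); apply: perm_big.
apply: uniq_perm; rewrite ?path_words_uniq //.
  rewrite map_inj_uniq ?enum_uniq // => t u /(can_inj encodeK) eq_tu.
  exact: val_inj.
move=> w; apply/mapP/idP => [[t _ ->]|w_in].
  have /eqP := ptree_valP t; rewrite nverts_encode => sz_t.
  have nz_t : encode t != [::].
    by apply/eqP => t0; move: d_gt1; rewrite -sz_t t0.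
  have := @flatten_encode_path [:: ptree_val t].
  have -> : (d - 1)%N = size (encode t) by rewrite subn1 -(congr1 predn sz_t).
  by rewrite /= cats0 nz_t; apply.
have [st [sz_st _ def_w]] := path_words_flatten w_in.
case: st => [|t [|]] // in sz_st def_w *; rewrite /= cats0 in def_w.
have sz_t : nverts t == d.
  rewrite nverts_encode -def_w (path_words_size w_in); lia.
by exists (PtreeOn sz_t); rewrite ?mem_enum.
Qed.

(** * Coefficients of f_d *)

(** The exponent k + m has the parity of k - m and avoids truncation when k < m. *)
Lemma coef_Xsub1_exp (k m : nat) :
  (('X - 1 : {poly rat}) ^+ k)`_m = (-1) ^+ (k + m) *+ 'C(k, m).
Proof.
rewrite addrC exprDn (eq_bigr (fun l : 'I__ =>
  ((-1) ^+ (k + l) *+ 'C(k, l)) *: 'X^l)) => [|l _].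
  rewrite -(poly_def _ (fun l => (-1) ^+ (k + l) *+ 'C(k, l))) coef_poly ltnS.
  by case: leqP => // lt_km; rewrite bin_small.
have le_lk : (l <= k)%N by rewrite -ltnS.
rewrite -scalerMnl -mul_polyC rmorphXn rmorphN1.
have -> : (k + l = k - l + 2 * l)%N by lia.
by rewrite exprD exprM sqrrN !expr1n mulr1.
Qed.

(** Coefficient reversal, since (1 - x)^k x^(d-k) = x^d (1 / x - 1)^k. *)
Lemma coef_1subX_exp (d k m : nat) : (k <= d)%N -> (m <= d)%N ->
  ((1 - 'X) ^+ k * 'X^(d - k) : {poly rat})`_(d - m) = (('X - 1) ^+ k)`_m.
Proof.
move=> le_kd le_md; rewrite coefMXn -opprB exprNn.
have -> : (-1) ^+ k = ((-1) ^+ k)%:P :> {poly rat} by rewrite rmorphXn rmorphN1.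
rewrite coefCM !coef_Xsub1_exp.
have [lt_km|le_mk] := ltnP k m.
  by rewrite ifT ?bin_small //; lia.
rewrite ifF; last by lia.
have -> : (d - m - (d - k) = k - m)%N by lia.
rewrite bin_sub // mulrnAr -exprD.
have -> : (k + (k + (k - m)) = k + m + 2 * (k - m))%N by lia.
by rewrite exprD exprM sqrrN !expr1n mulr1.
Qed.

Lemma toric_f_coef (d i j m : nat) : (0 < d)%N -> (m <= d)%N ->
  (toric_f d i j)`_(d - m) = (toric_sum ('X - 1) (d - 1) i j)`_m.
Proof.
case: d => [//|d] _ le_md; rewrite subn1 /=.
rewrite !coef_sum; apply: eq_bigr => k _.
rewrite subSS subn0 !mulr_natr !coefMn !coefZ coef_1subX_exp //;
  last exact: ltnW.
congr (_ *+ _); apply: eq_bigr => s _; congr (_ * 'C(_, _)); lia.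
Qed.

(* For m > d the exponent d - m is negative, so the coefficient is zero. *)
Theorem theorem3p13 (d i j : nat) (hd : (2 <= d)%N) (hi : (1 <= i)%N)
  (hj : (j < d - 1)%N) (hij : (i + j <= d - 1)%N) (m : nat) :
  (if (m <= d)%N then (toric_f d i j)`_(d - m) else 0)
  = #|[set t : ptree_on d | ncounted d i j t == m]|%:R.
Proof.
transitivity (toric_sum ('X - 1) (d - 1) i j)`_m.
  have [le_md|lt_dm] := leqP m d; first by rewrite toric_f_coef // ltnW.
  (* Only powers of ['X - 1] with exponent below d occur, so the coefficient vanishes for m > d. *)
  rewrite coef_sum big1 // => k _; rewrite mulr_natr coefMn coefZ.
  by rewrite coef_Xsub1_exp bin_small ?mulr0 ?mul0rn //; have := ltn_ord k; lia.
rewrite -word_gf_toric // -ptree_gf // coef_sum -sum1_card natr_sum.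
rewrite [RHS]big_mkcond /=; apply: eq_bigr => t _.
by rewrite coefXn inE eq_sym; case: eqP.
Qed.
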